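(* Let $\mathfrak{g}$ be a $14$-dimensional filiform Lie algebra over a field $k$ of characteristic zero with law $\lambda=(\alpha_{k,s})\in\mathcal{A}_{14,1}^2$ (normalized so that $\alpha_{2,5}=1$) such that $200\,\alpha_{3,8}-27\,\alpha_{2,6}\neq0$. Then $\mathfrak{g}$ is symplectic and characteristically nilpotent.
   Context: For a Lie algebra $\mathfrak{g}$ put $\mathfrak{g}^0=\mathfrak{g}$, $\mathfrak{g}^j=[\mathfrak{g}^{j-1},\mathfrak{g}]$. A nilpotent Lie algebra of dimension $n$ is filiform if $\mathfrak{g}^{n-1}=0$ and $\mathfrak{g}^{n-2}\neq 0$. A Lie algebra is symplectic if it admits a nondegenerate skew-symmetric bilinear form $\omega$ with $\omega([x,y],z)-\omega([x,z],y)+\omega([y,z],x)=0$ for all $x,y,z$. A Lie algebra is characteristically nilpotent (a CNLA) if all its derivations are nilpotent. Laws: let $\mathcal{I}_{14}=\{(k,s): 2\le k\le 7,\ 2k+1\le s\le 14\}\cup\{(7,14)\}$. Every filiform Lie algebra of dimension $14$ has an adapted basis $(e_1,\dots,e_{14})$, i.e. one in which the brackets are $[e_1,e_i]=e_{i+1}$ for $2\le i\le 13$, $[e_1,e_{14}]=0$, and $$[e_i,e_j]=\sum_{r=1}^{14}\Bigl(\sum_{\ell=0}^{\lfloor (j-i-1)/2\rfloor}(-1)^\ell\binom{j-i-\ell-1}{\ell}\alpha_{i+\ell,\,r-j+i+2\ell+1}\Bigr)e_r,\qquad 2\le i<j\le 14,$$ with constants $\alpha_{k,s}\in k$ that vanish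 for $(k,s)\notin\mathcal{I}_{14}$. $\mathcal{A}_{14}$ is the set of such laws (families $(\alpha_{k,s})$ for which the Jacobi identity holds). $\mathcal{A}_{14}^2$ is the set of laws in $\mathcal{A}_{14}$ whose algebras satisfy: (a) $\mathfrak{g}$ contains no one-codimensional subspace $U\supseteq\mathfrak{g}^1$ with $[U,\mathfrak{g}^1]\subseteq\mathfrak{g}^4$ (equivalently $\alpha_{2,5}\neq0$); (b) $\mathfrak{g}^{5}$ is abelian (equivalently $\alpha_{7,14}=0$); and which do not satisfy (c) $[\mathfrak{g}^1,\mathfrak{g}^1]\subseteq\mathfrak{g}^6$ (i.e. $\alpha_{3,7}\neq0$). If (a) holds, the adapted basis can be changed so that $\alpha_{2,5}=1$, and this normalization is assumed. $\mathcal{A}_{14,1}^2$ is the set of laws in $\mathcal{A}_{14}^2$ (with $\alpha_{2,5}=1$) satisfying $\alpha_{3,10}=P_{14}$, where $$P_{14}=\tfrac{1}{1307611305}\bigl(482832810500\,\alpha_{3,8}^3-157196008500\,\alpha_{3,8}^2\alpha_{2,6}+2223828750\,\alpha_{3,8}\alpha_{2,7}+16180336845\,\alpha_{3,8}\alpha_{2,6}^2+186801615\,\alpha_{2,8}-266859450\,\alpha_{2,7}\alpha_{2,6}-517476276\,\alpha_{2,6}^3\bigr).$$ *)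

(* Defs.v *)
From HB Require Import structures.
From mathcomp Require Import all_boot all_order all_algebra.

Set Implicit Arguments.
Unset Strict Implicit.
Unset Printing Implicit Defensive.

Import GRing.Theory.
Local Open Scope ring_scope.

Section LieAlgebras.

Variables (k : fieldType) (g : vectType k) (br : {bilinear g -> g -> g}).

Definition lie_bracket : Prop :=
  (forall x, br x x = 0) /\
  (forall x y z, br x (br y z) + br y (br z x) + br z (br x y) = 0).

(* [U, V], the linear span of all brackets; see brvP. *)
Definition brv (U V : {vspace g}) : {vspace g} :=
  <<[seq br u v | u <- vbasis U, v <- vbasis V]>>%VS.

Lemma brvP (U V W : {vspace g}) :
  reflect (forall u v, u \in U -> v \in V -> br u v \in W) (brv U V <= W)%VS.
Proof.
apply: (iffP idP) => [sW u v Uu Vv | UVW]; last first.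
  by apply/span_subvP=> _ /allpairsP[[u v] /= [Uu Vv ->]];
    apply: UVW; apply: vbasis_mem.
apply: (subvP sW); rewrite (coord_vbasis Uu) (coord_vbasis Vv).
rewrite linear_sumlz; apply: memv_suml => i _.
rewrite linear_sumr; apply: memv_suml => j _.
rewrite linearZl_LR /= linearZr_LR /= !memvZ // memv_span //.
by apply: allpairs_f; rewrite mem_nth ?size_tuple.
Qed.

(* The indexing starts at g^0 = g. *)
Definition lcs (j : nat) : {vspace g} :=
  iter j (fun U => brv U fullv) fullv.

Definition filiform (n : nat) : Prop :=
  [/\ \dim {:g} = n, lcs n.-1 = 0%VS & lcs n.-2 != 0%VS].

Definition derivation (D : 'End(g)) : Prop :=
  forall x y, D (br x y) = br (D x) y + br x (D y).

Definition nilpotent_end (D : 'End(g)) : Prop :=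
  exists m : nat, forall x, iter m D x = 0.

Definition characteristically_nilpotent : Prop :=
  forall D : 'End(g), derivation D -> nilpotent_end D.

Definition symplectic : Prop :=
  exists omega : {skew_symmetric g},
    nondegenerate omega /\
    forall x y z,
      omega (br x y) z - omega (br x z) y + omega (br y z) x = 0.

End LieAlgebras.

Section FiliformLaws14.

Variable k : fieldType.

Definition I14 (i s : nat) : bool :=
  [&& 2 <= i, i <= 7, 2 * i + 1 <= s & s <= 14]%N || (i == 7%N) && (s == 14%N).

(* The coefficient of e_r in [e_i, e_j].  In the second index of alpha the
   truncated subtraction is exact or returns 0, and alpha vanishes at (_, 0)
   by [adapted] below, as it does at negative indices. *)
Definition law_coef (alpha : nat -> nat -> k) (i j r : nat) : k :=
  \sum_(0 <= l < ((j - i - 1) %/ 2).+1)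
    (-1) ^+ l * 'C(j - i - l - 1, l)%:R *
    alpha (i + l)%N (r + i + 2 * l + 1 - j)%N.

Variables (g : vectType k) (br : {bilinear g -> g -> g}).

(* e 1, ..., e 14 is an adapted basis of g in which the law of g is alpha; the
   values of e outside 1..14 are irrelevant. *)
Definition adapted (e : nat -> g) (alpha : nat -> nat -> k) : Prop :=
  [/\ basis_of fullv [seq e i | i <- iota 1 14],
      forall i s, ~~ I14 i s -> alpha i s = 0,
      forall i, (2 <= i <= 13)%N -> br (e 1%N) (e i) = e i.+1,
      br (e 1%N) (e 14%N) = 0 &
      forall i j, (2 <= i)%N -> (i < j)%N -> (j <= 14)%N ->
        br (e i) (e j) = \sum_(1 <= r < 15) law_coef alpha i j r *: e r].

Definition condition_a : Prop :=
  ~ exists U : {vspace g},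
      [/\ ((\dim U).+1 = \dim {:g})%N, (lcs br 1 <= U)%VS &
          (brv br U (lcs br 1) <= lcs br 4)%VS].

Definition condition_b : Prop := brv br (lcs br 5) (lcs br 5) = 0%VS.

Definition condition_c : Prop :=
  (brv br (lcs br 1) (lcs br 1) <= lcs br 6)%VS.

(* alpha ranges over laws of Lie algebras: the Jacobi identity for alpha is
   [lie_bracket br] read in the basis e.  The last clause is the normalization
   available under condition_a. *)
Definition in_A14_2 (e : nat -> g) (alpha : nat -> nat -> k) : Prop :=
  [/\ adapted e alpha, condition_a, condition_b, ~ condition_c &
      alpha 2%N 5%N = 1].

Definition P14 (alpha : nat -> nat -> k) : k :=
  1307611305%:R^-1 *
    (482832810500%:R * alpha 3%N 8%N ^+ 3
     - 157196008500%:R * alpha 3%N 8%N ^+ 2 * alpha 2%N 6%N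
     + 2223828750%:R * alpha 3%N 8%N * alpha 2%N 7%N
     + 16180336845%:R * alpha 3%N 8%N * alpha 2%N 6%N ^+ 2
     + 186801615%:R * alpha 2%N 8%N
     - 266859450%:R * alpha 2%N 7%N * alpha 2%N 6%N
     - 517476276%:R * alpha 2%N 6%N ^+ 3).

Definition in_A14_1_2 (e : nat -> g) (alpha : nat -> nat -> k) : Prop :=
  in_A14_2 e alpha /\ alpha 3%N 10%N = P14 alpha.

End FiliformLaws14.

(* Main.v *)
(* Symplectic part.  A 2-form omega with omega(e_1, e_j) the e_14-coordinate of
   e_j is closed on triples (e_1, e_i, e_j) exactly when omega(e_i, e_j) is the
   would-be coefficient of a fifteenth vector e_15 in [e_i, e_j], for a choice
   of new constants alpha_{2,15}, ..., alpha_{7,15}.  Then d omega is invariant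
   under e_1, so it vanishes as soon as it does on (e_2, e_3, e_l), l <= 10, and
   on (e_4, e_5, e_6).  With the degree s - 2k - 1 given to alpha_{k,s}, the
   equations of degree 0, 2, 4, 6 determine alpha_{7,15}, alpha_{6,15},
   alpha_{5,15}, alpha_{4,15}; that of degree 1 follows from the Jacobi identity
   of the law, that of degree 5 from e_1-invariance, and that of degree 3 is
   alpha_{3,10} = P14.  The Jacobi identity forces alpha_{3,7} = 1/10, and the
   form is nondegenerate because it is antitriangular.

   Derivations.  A derivation D is triangular in the adapted basis, with
   diagonal (x, 2x, 3x, ...).  The first off-diagonal of the Leibniz rule on
   [e_2, e_3] and [e_3, e_4] gives two values for the e_2-coordinate of D e_1,
   whence (200 alpha_{3,8} - 27 alpha_{2,6}) x = 0. *)
Require Import Defs.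
From HB Require Import structures.
From mathcomp Require Import all_boot all_order all_algebra.
From mathcomp Require Import ring zify.
Import GRing.Theory.
Local Open Scope ring_scope.

Set Implicit Arguments.
Unset Strict Implicit.
Unset Printing Implicit Defensive.

(** * Structure constants and Jacobi sums *)

Section StructureConstants.

Variable k : fieldType.
Implicit Type a : nat -> nat -> k.

(** Meant for i < j. With [r = 15] the branch [i = 1] gives [e_1, e_14] the coefficient 1 on the
    fictitious e_15, which is the value omega(e_1, e_14). *)
Definition half_str a (i j r : nat) : k :=
  if i == 1%N then (r == j.+1)%:R else law_coef a i j r.

(* [str a i j r] is the coefficient of [e r] in the bracket of [e i] and [e j]. *)
Definition str a (i j r : nat) : k :=
  if (i < j)%N then half_str a i j r
  else if (j < i)%N then - half_str a j i r else 0.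

(* The [e r]-coordinate of the Jacobi sum of [e i], [e j], [e l]; for [r = 15], the value on
   these vectors of the differential of the 2-form with matrix [str a _ _ 15]. *)
Definition jac a (i j l r : nat) : k :=
  \sum_(1 <= m < 15) (str a i j m * str a m l r + str a j l m * str a m i r
                      + str a l i m * str a m j r).

(* The indices [I14], without (7, 14) and with the column [s = 15] added. *)
Definition supp15 (i s : nat) : bool :=
  [&& 2 <= i, i <= 7, 2 * i + 1 <= s & s <= 15]%N.

Definition supported a := forall i s, ~~ supp15 i s -> a i s = 0.

Lemma strC a i j r : str a j i r = - str a i j r.
Proof. by rewrite /str; case: ltngtP; rewrite ?opprK ?oppr0. Qed.

Lemma strii a i r : str a i i r = 0.
Proof. by rewrite /str ltnn. Qed.

Lemma str1 a j r : (1 < j)%N -> str a 1 j r = (r == j.+1)%:R.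
Proof. by rewrite /str => ->. Qed.

Lemma str1_eq a j : (1 < j)%N -> str a 1 j j.+1 = 1.
Proof. by move=> j1; rewrite str1 ?eqxx. Qed.

Lemma str1_neq a j r : (1 < j)%N -> r != j.+1 -> str a 1 j r = 0.
Proof. by move=> j1 /negPf rj; rewrite str1 ?rj. Qed.

(** A nonzero alpha_{k,s} has s >= 2k + 1; for k = i + l and s = r - j + i + 2l + 1 this says r >= i
    + j. *)
Lemma law_coef_small a i j r : supported a -> (i < j)%N -> (r < i + j)%N ->
  law_coef a i j r = 0.
Proof.
move=> sa ij rij; rewrite /law_coef big1_seq // => l.
rewrite mem_index_iota => /andP[_ hl].
rewrite sa ?mulr0 // /supp15; apply/negP => /and4P[]; lia.
Qed.

Lemma str_small a i j r : supported a -> (1 < i)%N -> (1 < j)%N ->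
  (r < i + j)%N -> str a i j r = 0.
Proof.
move=> sa i1 j1 rij; rewrite /str /half_str.
case: ltngtP => // ij; rewrite gtn_eqF // law_coef_small ?oppr0 // addnC.
exact: rij.
Qed.

(* Lists of integer coefficients and indices of the alpha, so that [vm_compute] turns
   a Jacobi sum into an explicit polynomial. *)
Definition half_terms (i j r : nat) : seq (int * (nat * nat)) :=
  [seq ((-1) ^+ l * 'C(j - i - l - 1, l)%:Z, (i + l, r + i + 2 * l + 1 - j)%N)
  | l <- iota 0 ((j - i - 1) %/ 2).+1 & supp15 (i + l)%N (r + i + 2 * l + 1 - j)%N].

Definition str_terms (i j r : nat) : seq (int * (nat * nat)) :=
  if (i < j)%N then half_terms i j r
  else if (j < i)%N then [seq (- x.1, x.2) | x <- half_terms j i r] else [::].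

Definition jac_terms (i j l r : nat) : seq (int * ((nat * nat) * (nat * nat))) :=
  flatten [seq flatten [seq
      [seq (x.1 * y.1, (x.2, y.2)) | x <- str_terms q.1.1 q.1.2 m, y <- str_terms m q.2 r]
    | q <- [:: (i, j, l); (j, l, i); (l, i, j)]] | m <- iota 2 13].

Lemma strE a i j r : supported a -> (1 < i)%N -> (1 < j)%N ->
  str a i j r = \sum_(x <- str_terms i j r) x.1%:~R * a x.2.1 x.2.2.
Proof.
move=> sa i1 j1.
have halfE i' j' : law_coef a i' j' r =
    \sum_(x <- half_terms i' j' r) x.1%:~R * a x.2.1 x.2.2.
  rewrite /half_terms big_map big_filter /law_coef /index_iota subn0.
  move: (_ %/ 2).+1 => n; rewrite [RHS]big_mkcond /=; apply: eq_big => // l _.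
  case: ifP => [_|/negbT /sa->]; last by rewrite mulr0.
  by rewrite intrM rmorphXn /= rmorphN1.
rewrite /str /str_terms /half_str !gtn_eqF //.
case: ltngtP => _; rewrite ?halfE ?big_nil //.
by rewrite [RHS]big_map -sumrN; apply: eq_bigr => x _; rewrite rmorphN mulNr.
Qed.

Lemma jacE a i j l r : supported a -> (1 < i)%N -> (1 < j)%N -> (1 < l)%N ->
  jac a i j l r =
  \sum_(x <- jac_terms i j l r) x.1%:~R * (a x.2.1.1 x.2.1.2 * a x.2.2.1 x.2.2.2).
Proof.
(* [jac_terms] starts at m = 2: brackets of vectors e_x with x > 1 have no e_1-coordinate. *)
move=> sa i1 j1 l1; rewrite /jac big_ltn // !(@str_small _ _ _ 1) //; try lia.
rewrite !mul0r !add0r big_flatten big_map; apply: eq_big_seq => m.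
rewrite mem_iota => /andP[m1 _].
rewrite big_flatten big_map !big_cons big_nil /= addr0 addrA.
have prodE i' j' l' : (1 < i')%N -> (1 < j')%N -> (1 < l')%N ->
    str a i' j' m * str a m l' r =
    \sum_(x <- [seq (x.1 * y.1, (x.2, y.2)) | x <- str_terms i' j' m, y <- str_terms m l' r])
      x.1%:~R * (a x.2.1.1 x.2.1.2 * a x.2.2.1 x.2.2.2).
  move=> h1 h2 h3; rewrite big_allpairs_dep /= !strE // mulr_suml.
  apply: eq_bigr => x _.
  rewrite mulr_sumr; apply: eq_bigr => y _ /=.
  by rewrite intrM mulrACA.
by rewrite !prodE.
Qed.

(** A plain recursion, so that [cbv] unfolds it into an explicit polynomial once the list is
    computed. *)
Fixpoint jac_val a (s : seq (int * ((nat * nat) * (nat * nat)))) : k :=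
  if s is x :: s' then
    x.1%:~R * (a x.2.1.1 x.2.1.2 * a x.2.2.1 x.2.2.2) + jac_val a s'
  else 0.

Lemma jac_valE a i j l r : supported a -> (1 < i)%N -> (1 < j)%N -> (1 < l)%N ->
  jac a i j l r = jac_val a (jac_terms i j l r).
Proof.
move=> sa i1 j1 l1; rewrite jacE //.
by elim: (jac_terms _ _ _ _) => [|x s IH]; rewrite ?big_nil // big_cons IH.
Qed.

End StructureConstants.

Tactic Notation "jac_eval" uconstr(sa) :=
  match goal with |- context [jac ?a ?i ?j ?l ?r] =>
    rewrite (@jac_valE _ a i j l r sa isT isT isT) end;
  match goal with |- context [jac_terms ?i ?j ?l ?r] =>
    let s := eval vm_compute in (jac_terms i j l r) in
    change (jac_terms i j l r) with s end;
  cbv [jac_val fst snd].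

Tactic Notation "str_eval" uconstr(sa) :=
  match goal with |- context [str ?a ?i ?j ?r] =>
    rewrite (@strE _ a i j r sa isT isT);
    let s := eval vm_compute in (str_terms i j r) in
    change (str_terms i j r) with s
  end; rewrite !big_cons big_nil /=.

(** Pattern of the eliminations below: r is a vanishing polynomial, c the coefficient of the unknown
    x in it, y the proposed solution; the last premise is left to [ring] or [field]. *)
Lemma lin_solve (k : fieldType) (c x y r : k) :
  r = 0 -> c != 0 -> r = c * (x - y) -> x = y.
Proof.
by move=> -> c0 /esym/eqP; rewrite mulf_eq0 (negPf c0) subr_eq0 => /eqP.
Qed.
Arguments lin_solve {k} c {x y r}.

Lemma lin_comb (k : fieldType) (c r s : k) : r = 0 -> s = 0 -> r + c * s = 0.
Proof. by move=> -> ->; rewrite mulr0 addr0. Qed.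
Arguments lin_comb {k} c {r s}.

(** * Solving the Jacobi identities *)

Section JacobiIdeal.

Variables (k : fieldType) (a : nat -> nat -> k).
Hypothesis char0 : [pchar k] =i pred0.
Hypothesis sa : supported a.
Hypothesis a25 : a 2 5 = 1.
Hypothesis a37_neq0 : a 3 7 != 0.
Hypothesis jac0 : forall i j l r, (1 < i)%N -> (1 < j)%N -> (1 < l)%N ->
  (i <= 14)%N -> (j <= 14)%N -> (l <= 14)%N -> (0 < r <= 14)%N -> jac a i j l r = 0.

Lemma natr_neq0 n : n != 0%N -> n%:R != 0 :> k.
Proof. by rewrite (pcharf0P k).1. Qed.

Ltac solve_neq0 := by rewrite ?(mulf_neq0, oppr_eq0, natr_neq0, oner_eq0).

Tactic Notation "use_jac" uconstr(i) uconstr(j) uconstr(l) uconstr(r) ident(E) :=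
  have E := @jac0 i j l r isT isT isT isT isT isT isT;
  rewrite (@jac_valE _ a i j l r sa isT isT isT) in E;
  let s := eval vm_compute in (jac_terms i j l r) in
  change (jac_terms i j l r) with s in E;
  cbv [jac_val fst snd] in E.

(** The first identity reads (2 + x) b = 3 x^2, so x = -2 would give 12 = 0. The other two determine
    c and then relate x and b; cancelling b and substituting its value leaves 12 x^3 (10 x - 1) =
    0. *)
Lemma ten_a37 : 10%:R * a 3 7 = 1.
Proof.
use_jac 2 3 4 9 E1; use_jac 2 4 5 11 E2; use_jac 3 4 5 12 E3.
move: E1 E2 E3; rewrite a25.
set x := a 3 7; set b := a 4 9; set c := a 5 11 => E1 E2 E3.
have x2 : 2%:R + x != 0.
  apply/eqP=> /eqP; rewrite addrC addr_eq0 => /eqP x2.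
  have /eqP := natr_neq0 (isT : 12 != 0)%N; apply.
  by rewrite -[RHS]E1 x2; ring.
have bE : b = 3%:R * x ^+ 2 / (2%:R + x).
  apply: (mulfI x2); rewrite mulrCA divff // mulr1.
  have /(lin_solve (-1)) := E1; apply; last ring.
  by rewrite oppr_eq0 oner_eq0.
have b0 : b != 0 by rewrite bE !mulf_neq0 ?invr_eq0 ?expf_neq0 ?natr_neq0.
have cE : 6%:R * c = 12%:R * x * b - 14%:R * b ^+ 2.
  have /(lin_solve (-1)) := lin_comb 3%:R E3 E2; apply; last ring.
  by rewrite oppr_eq0 oner_eq0.
have F : - (x + b) * (12%:R * x - 14%:R * b) + 8%:R * b = 0.
  apply: (mulfI b0); rewrite mulr0 -[RHS](mulr0 2%:R) -E3.
  transitivity (- (x + b) * (12%:R * x * b - 14%:R * b ^+ 2) + 8%:R * b ^+ 2); first ring.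
  by rewrite -cE; ring.
have := congr1 ( *%R ((2%:R + x) ^+ 2)) F.
rewrite mulr0 => /(lin_solve (12%:R * x ^+ 3)); apply.
  by rewrite mulf_neq0 ?expf_neq0 ?natr_neq0.
by rewrite bE; field.
Qed.

(* The Jacobi identities are homogeneous in the alpha (with [a 2 5] for 1), so every alpha
   is written as [t = 1 / 60060] times an integral polynomial in rescaled free parameters
   [u, v, p]; all verifications below are then identities over the integers. *)
Let t : k := (60%:R * 1001%:R)^-1.

Let t_neq0 : t != 0.
Proof. by rewrite invr_eq0; solve_neq0. Qed.

Let tE : 60060%:R * t = 1.
Proof.
have <- : 60%:R * 1001%:R = 60060%:R :> k by ring.
by rewrite mulfV //; solve_neq0.
Qed.

(** The leading constants alpha_{k,2k+1} are 1, 1/10, 1/70, 1/420, 1/2310, and 1/12012 for the added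
    alpha_{7,15}; 60060 is their least common denominator. *)
Let a25E : a 2 5 = 60060%:R * t. Proof. by rewrite tE. Qed.

Let a37E : a 3 7 = 6006%:R * t.
Proof.
apply: (mulfI (natr_neq0 (isT : 10 != 0)%N)).
by rewrite ten_a37 -[LHS]tE; ring.
Qed.

Let a49E : a 4 9 = 858%:R * t.
Proof.
use_jac 2 3 4 9 E; move: E.
(* The coefficient of the unknown alpha_{4,9}, namely -(2 + alpha_{3,7}) = -21/10. Such multipliers
   are kept as products of small numerals for [natr_neq0]. *)
move=> /(lin_solve (- (882%:R * 143%:R * t))); apply; first by solve_neq0.
by rewrite ?(a25E, a37E); ring.
Qed.

Let a511E : a 5 11 = 143%:R * t.
Proof.
use_jac 3 4 5 12 E; move: E.
move=> /(lin_solve (- (144%:R * 143%:R * t))); apply; first by solve_neq0.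
by rewrite ?(a25E, a37E, a49E); ring.
Qed.

Let a613E : a 6 13 = 26%:R * t.
Proof.
use_jac 2 5 6 13 E; move: E.
move=> /(lin_solve (- (605%:R * 169%:R * t))); apply; first by solve_neq0.
by rewrite ?(a25E, a37E, a49E, a511E); ring.
Qed.

Let v : k := a 2 6 / (360%:R * 49%:R * 1331%:R * 169%:R * t).

Let a26E : a 2 6 = 3967923960%:R * v * t.
Proof.
have c0 : 360%:R * 49%:R * 1331%:R * 169%:R * t != 0 by solve_neq0.
transitivity (v * (360%:R * 49%:R * 1331%:R * 169%:R * t)); last ring.
by rewrite /v divfK.
Qed.

Let u : k := a 3 8 / (108%:R * 49%:R * 1331%:R * 169%:R * t).

Let a38E : a 3 8 = 1190377188%:R * u * t.
Proof.
have c0 : 108%:R * 49%:R * 1331%:R * 169%:R * t != 0 by solve_neq0.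
transitivity (u * (108%:R * 49%:R * 1331%:R * 169%:R * t)); last ring.
by rewrite /u divfK.
Qed.

Let p : k := a 2 7 / (462%:R * 13%:R * t).

Let a27E : a 2 7 = 6006%:R * p * t.
Proof.
have c0 : 462%:R * 13%:R * t != 0 by solve_neq0.
transitivity (p * (462%:R * 13%:R * t)); last ring.
by rewrite /p divfK.
Qed.

(** In degree s - 2k - 1 = 1 each identity used brings a single new unknown, which comes out linear
    in [u] and [v]. *)
Let a410E : a 4 10 = (372498984%:R * u - 80978040%:R * v) * t.
Proof.
use_jac 2 3 4 10 E; move: E.
move=> /(lin_solve (- (882%:R * 143%:R * t))); apply; first by solve_neq0.
by rewrite ?(a25E, a37E, a49E, a511E, a613E,
  a26E, a38E, a27E); ring.
Qed.

Let a512E : a 5 12 = (94576625%:R * u - 27094925%:R * v) * t.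
Proof.
use_jac 2 3 6 12 E; move: E.
move=> /(lin_solve (72%:R * 121%:R * 13%:R * t)); apply; first by solve_neq0.
by rewrite ?(a25E, a37E, a49E, a511E, a613E,
  a26E, a38E, a27E, a410E); ring.
Qed.

Let a614E : a 6 14 = (22537814%:R * u - 7205354%:R * v) * t.
Proof.
use_jac 2 3 8 14 E; move: E.
move=> /(lin_solve (- (605%:R * 169%:R * t))); apply; first by solve_neq0.
by rewrite ?(a25E, a37E, a49E, a511E, a613E,
  a26E, a38E, a27E, a410E, a512E); ring.
Qed.

(** In degree 2 the unknowns alpha_{3,9}, alpha_{4,11}, alpha_{5,13} are tied together by three
    identities. *)
Let a39E : a 3 9 =
  (404059251940344%:R * u ^+ 2 + 28990446036552%:R * v ^+ 2
   - 241194225832560%:R * (u * v) + 858%:R * p) * t.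
Proof.
(* The multipliers eliminate [a 4 11] and [a 5 13]. *)
use_jac 2 3 7 14 E.
use_jac 2 3 6 13 E'.
use_jac 2 3 4 11 E''.
have := lin_comb (718%:R) (lin_comb (- 1540%:R) (lin_comb 847%:R (erefl 0) E) E') E''.
move=> /(lin_solve (- (10%:R * 1001%:R * t))); apply; first by solve_neq0.
by rewrite ?(a25E, a37E, a49E, a511E, a613E,
  a26E, a38E, a27E, a410E, a512E, a614E); ring.
Qed.

Let a411E : a 4 11 =
  (172285420141692%:R * u ^+ 2 + 17536272332436%:R * v ^+ 2
   - 115175957050440%:R * (u * v) + 143%:R * p) * t.
Proof.
use_jac 2 3 4 11 E; move: E.
move=> /(lin_solve (- (882%:R * 143%:R * t))); apply; first by solve_neq0.
by rewrite ?(a25E, a37E, a49E, a511E, a613E,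
  a26E, a38E, a27E, a410E, a512E, a614E, a39E); ring.
Qed.

Let a513E : a 5 13 =
  (53783408354819%:R * u ^+ 2 + 6335219274527%:R * v ^+ 2
   - 37984260229630%:R * (u * v) + 26%:R * p) * t.
Proof.
use_jac 2 3 6 13 E; move: E.
move=> /(lin_solve (72%:R * 121%:R * 13%:R * t)); apply; first by solve_neq0.
by rewrite ?(a25E, a37E, a49E, a511E, a613E,
  a26E, a38E, a27E, a410E, a512E, a614E, a39E, a411E); ring.
Qed.

(** * The added column s = 15 and the closedness equations *)

Let beta6 : k :=
  (14859740064566%:R * u ^+ 2 + 1895758240850%:R * v ^+ 2
   - 10835113241152%:R * (u * v) + 5%:R * p) * t.

Ltac subst_all := rewrite ?(a25E, a37E, a49E, a511E, a613E,
  a26E, a38E, a27E, a410E, a512E, a614E, a39E, a411E, a513E).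

Definition ext (b : nat -> k) (i s : nat) : k := if s == 15%N then b i else a i s.

(** The entry [beta6] solves the degree 2 equation, on (2, 3, 8). The constants alpha_{2,15} and
    alpha_{3,15} have degrees 10 and 8, while no equation has degree above 6, so they may be 0. *)
Definition top_coefs (x4 x5 : k) (i : nat) : k :=
  nth 0 [:: 0; 0; 0; 0; x4; x5; beta6; 5%:R * t] i.

Lemma ext_supported x4 x5 : supported (ext (top_coefs x4 x5)).
Proof.
move=> i s; rewrite /ext; case: eqP => [->|_]; last exact: sa.
rewrite /supp15 /top_coefs; case: (ltnP 7 i) => i7; first by rewrite nth_default.
by case: i i7 => [|[|[|[|[|[|[|[|]]]]]]]].
Qed.

Hypothesis a310 : 1307611305%:R * a 3 10 -
  (482832810500%:R * a 3 8 ^+ 3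
   - 157196008500%:R * a 3 8 ^+ 2 * a 2 6
   + 2223828750%:R * a 3 8 * a 2 7
   + 16180336845%:R * a 3 8 * a 2 6 ^+ 2
   + 186801615%:R * a 2 8
   - 266859450%:R * a 2 7 * a 2 6
   - 517476276%:R * a 2 6 ^+ 3) = 0.

Ltac ext_eval := jac_eval (@ext_supported _ _); rewrite /ext /top_coefs /=.

(** The equation on (2, 3, l) has degree 10 - l. This one and that on (4, 5, 6) have degree 0 and
    involve only the leading constants. *)
Lemma jac_ext_2_3_10 x4 x5 : jac (ext (top_coefs x4 x5)) 2 3 10 15 = 0.
Proof. by ext_eval; subst_all; rewrite /beta6; ring. Qed.

Lemma jac_ext_4_5_6 x4 x5 : jac (ext (top_coefs x4 x5)) 4 5 6 15 = 0.
Proof. by ext_eval; subst_all; rewrite /beta6; ring. Qed.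

Lemma jac_ext_2_3_9 x4 x5 : jac (ext (top_coefs x4 x5)) 2 3 9 15 = 0.
Proof. by ext_eval; subst_all; rewrite /beta6; ring. Qed.

Lemma jac_ext_2_3_8 x4 x5 : jac (ext (top_coefs x4 x5)) 2 3 8 15 = 0.
Proof. by ext_eval; subst_all; rewrite /beta6; ring. Qed.

Lemma jac_ext_2_3_7 x4 x5 : jac (ext (top_coefs x4 x5)) 2 3 7 15 = 0.
Proof.
(* Powers of alpha_{2,5} = 1 make the condition on alpha_{3,10} homogeneous of degree 3 in the
   alphas, so that the powers of [t] match after substitution. *)
have H : 1307611305%:R * a 2 5 ^+ 2 * a 3 10 -
  (482832810500%:R * a 3 8 ^+ 3
  - 157196008500%:R * a 3 8 ^+ 2 * a 2 6
  + 2223828750%:R * a 2 5 * a 3 8 * a 2 7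
  + 16180336845%:R * a 3 8 * a 2 6 ^+ 2
  + 186801615%:R * a 2 5 ^+ 2 * a 2 8
  - 266859450%:R * a 2 5 * a 2 7 * a 2 6
  - 517476276%:R * a 2 6 ^+ 3) = 0.
  have /(lin_solve 1) := a310; apply; first exact: oner_neq0.
  by rewrite a25; ring.
ext_eval.
(* The multipliers eliminate [a 4 12] and [a 5 14]; what remains is [H]. *)
use_jac 2 3 6 14 E5.
use_jac 2 3 4 12 E4.
have := lin_comb (2522788017750%:R * a 2 5)
  (lin_comb (- 5416216205400%:R * a 2 5) H E5) E4.
move=> /(lin_solve (- (270%:R * 343%:R * 14641%:R * 2197%:R * (60%:R * 1001%:R * t)))).
apply; first by solve_neq0.
by subst_all; rewrite /beta6; ring.
Qed.

(** The equation has degree 4, that of alpha_{5,15}, which enters linearly with nonzero coefficient;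
    alpha_{4,15}, of degree 6, does not enter. Hence [x5] can be chosen first, and [x4] afterwards
    from (2, 3, 4). *)
Lemma jac_ext_2_3_6 : exists x5, forall x4, jac (ext (top_coefs x4 x5)) 2 3 6 15 = 0.
Proof.
have c0 : 72%:R * 121%:R * 13%:R * t != 0 by solve_neq0.
have affine x4 x5 : jac (ext (top_coefs x4 x5)) 2 3 6 15 =
    jac (ext (top_coefs 0 0)) 2 3 6 15 + x5 * (72%:R * 121%:R * 13%:R * t).
  by do 2 ext_eval; subst_all; ring.
exists (- jac (ext (top_coefs 0 0)) 2 3 6 15 / (72%:R * 121%:R * 13%:R * t)) => x4.
by rewrite affine divfK // subrr.
Qed.

Lemma jac_ext_2_3_4 x5 : exists x4, jac (ext (top_coefs x4 x5)) 2 3 4 15 = 0.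
Proof.
have c0 : - (882%:R * 143%:R * t) != 0 by solve_neq0.
have affine x4 : jac (ext (top_coefs x4 x5)) 2 3 4 15 =
    jac (ext (top_coefs 0 x5)) 2 3 4 15 + x4 * (- (882%:R * 143%:R * t)).
  by do 2 ext_eval; subst_all; ring.
exists (- jac (ext (top_coefs 0 x5)) 2 3 4 15 / (- (882%:R * 143%:R * t))).
by rewrite affine divfK // subrr.
Qed.

(** Entries with index sum 15 have degree 0, so they depend on the leading constants only; half of
    them suffice by skew symmetry. *)
Lemma str_ext_neq0 x4 x5 i : (0 < i < 15)%N ->
  str (ext (top_coefs x4 x5)) i (15 - i) 15 != 0.
Proof.
set A := ext _.
have half j : (0 < j < 8)%N -> str A j (15 - j) 15 != 0.
  case: j => [|[|[|[|[|[|[|[|j]]]]]]]] // _; first by rewrite str1 ?oner_neq0.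
  - have -> : str A 2 13 15 = 15%:R * 1694%:R * t.
      by str_eval (@ext_supported x4 x5); rewrite /A /ext /top_coefs /=; subst_all; ring.
    by solve_neq0.
  - have -> : str A 3 12 15 = 1890%:R * t.
      by str_eval (@ext_supported x4 x5); rewrite /A /ext /top_coefs /=; subst_all; ring.
    by solve_neq0.
  - have -> : str A 4 11 15 = 294%:R * t.
      by str_eval (@ext_supported x4 x5); rewrite /A /ext /top_coefs /=; subst_all; ring.
    by solve_neq0.
  - have -> : str A 5 10 15 = 70%:R * t.
      by str_eval (@ext_supported x4 x5); rewrite /A /ext /top_coefs /=; subst_all; ring.
    by solve_neq0.
  - have -> : str A 6 9 15 = 21%:R * t.
      by str_eval (@ext_supported x4 x5); rewrite /A /ext /top_coefs /=; subst_all; ring.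
    by solve_neq0.
  - have -> : str A 7 8 15 = 5%:R * t.
      by str_eval (@ext_supported x4 x5); rewrite /A /ext /top_coefs /=; subst_all; ring.
    by solve_neq0.
move=> iP; case: (ltnP i 8) => i8; first by apply: half; lia.
rewrite strC oppr_eq0; have := half (15 - i)%N; rewrite subKn; last by lia.
by apply; lia.
Qed.

(** The value l = 5 is absent from the list: (2, 3, 5) is obtained from e_1-invariance in
    [jac_sorted]. *)
Lemma exists_extension : exists b : nat -> k,
  [/\ supported (ext b),
      forall i, (0 < i < 15)%N -> str (ext b) i (15 - i) 15 != 0,
      forall l, l \in [:: 4; 6; 7; 8; 9; 10]%N -> jac (ext b) 2 3 l 15 = 0 &
      jac (ext b) 4 5 6 15 = 0].
Proof.
have [x5 x5P] := jac_ext_2_3_6; have [x4 x4P] := jac_ext_2_3_4 x5.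
exists (top_coefs x4 x5); split.
- exact: ext_supported.
- exact: str_ext_neq0.
- move=> l; rewrite !inE.
  do 5! (case/orP => [/eqP->|]; first by
    first [exact: x4P | exact: x5P | exact: jac_ext_2_3_7 | exact: jac_ext_2_3_8
      | exact: jac_ext_2_3_9]).
  by move/eqP->; exact: jac_ext_2_3_10.
- exact: jac_ext_4_5_6.
Qed.

End JacobiIdeal.

(** * Vanishing of the differential by e_1-invariance *)

Section Pascal.
Variable k : fieldType.
Implicit Type A : nat -> nat -> k.

(** Beyond the original upper limit the binomial coefficient is 0, so sums of different lengths
    become comparable. *)
Lemma law_coef_widen A i j r N : ((j - i - 1) %/ 2 < N)%N ->
  law_coef A i j r = \sum_(0 <= l < N)
    (-1) ^+ l * 'C(j - i - l - 1, l)%:R * A (i + l)%N (r + i + 2 * l + 1 - j)%N.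
Proof.
move=> ltN; rewrite [RHS](big_cat_nat (n := ((j - i - 1) %/ 2).+1)) //=.
rewrite [X in _ + X]big1_seq ?addr0 // => l.
rewrite mem_index_iota => /andP[_ /andP[h _]].
rewrite bin_small ?mulr0 ?mul0r //; lia.
Qed.

(** The law is built so that ad e_1 obeys the Leibniz rule; on coefficients, after an index shift in
    two of the sums, this is Pascal's rule. *)
Lemma law_coef_pascal A i j r : (i.+1 < j)%N ->
  law_coef A i j r = law_coef A i.+1 j r.+1 + law_coef A i j.+1 r.+1.
Proof.
move=> ij; rewrite (@law_coef_widen A i j r j.+1); last lia.
rewrite (@law_coef_widen A i.+1 j _ j); last lia.
rewrite (@law_coef_widen A i j.+1 _ j.+1); last lia.
rewrite [LHS]big_nat_recl // [X in _ = _ + X]big_nat_recl // addrCA.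
rewrite -big_split /=; congr (_ + _).
  by rewrite !bin0; congr (_ * A _ _); lia.
apply: eq_big_nat => l lj.
have -> : (r.+1 + i.+1 + 2 * l + 1 - j = r + i + 2 * l.+1 + 1 - j)%N by lia.
have -> : (r.+1 + i + 2 * l.+1 + 1 - j.+1 = r + i + 2 * l.+1 + 1 - j)%N by lia.
rewrite addSnnS -mulrDl exprS; congr (_ * _).
have -> : 'C(j.+1 - i - l.+1 - 1, l.+1) =
    ('C(j - i - l.+1 - 1, l.+1) + 'C(j - i.+1 - l - 1, l))%N.
  have [h|h] := leqP (j - i - 1) l.
    by rewrite !bin_small //; lia.
  have -> : (j.+1 - i - l.+1 - 1 = (j - i - l.+1 - 1).+1)%N by lia.
  by rewrite binS; congr (_ + 'C(_, _))%N; lia.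
rewrite natrD; ring.
Qed.

Lemma str_pascal A i j r : supported A -> (1 < i)%N -> (1 < j)%N ->
  str A i.+1 j r.+1 + str A i j.+1 r.+1 = str A i j r.
Proof.
move=> sA; wlog ij : i j / (i <= j)%N => [wl i1 j1 | i1 j1].
  have [ij|/ltnW ji] := leqP i j; first exact: wl.
  by rewrite addrC (strC _ j) (strC _ j.+1) -opprD wl // -strC.
have [->|nij] := eqVneq i j; first by rewrite strii (strC A j.+1) subrr.
have {}ij : (i < j)%N by rewrite ltn_neqAle nij.
(* For j = i + 1 both surviving sums reduce to the term l = 0, with the same alpha. *)
have [<-|nSij] := eqVneq i.+1 j.
  rewrite strii add0r /str ltnSn ltnS leqnSn /half_str gtn_eqF //.
  rewrite (@law_coef_widen A i i.+2 r.+1 1); last lia.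
  rewrite (@law_coef_widen A i i.+1 r 1); last lia.
  by rewrite !big_nat1 !bin0; congr (_ * A _ _); lia.
have {}nSij : (i.+1 < j)%N by rewrite ltn_neqAle nSij.
rewrite /str nSij ij (ltn_trans ij (ltnSn j)) /half_str !gtn_eqF //; last by lia.
by rewrite -law_coef_pascal.
Qed.

Lemma jac_cycle A i j l r : jac A i j l r = jac A j l i r.
Proof. by apply: eq_bigr => m _; rewrite [RHS]addrC addrA. Qed.

Lemma jac_swap A i j l r : jac A j i l r = - jac A i j l r.
Proof.
rewrite -sumrN; apply: eq_bigr => m _.
rewrite (strC _ i j) (strC _ l i) (strC _ j l); ring.
Qed.

Lemma jac_iil A i l r : jac A i i l r = 0.
Proof.
apply: big1 => m _; rewrite strii (strC _ i l); ring.
Qed.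

Lemma jac_iji A i j r : jac A i j i r = 0.
Proof. by rewrite -jac_cycle jac_iil. Qed.

Lemma jac_ijj A i j r : jac A i j j r = 0.
Proof. by rewrite jac_cycle jac_iil. Qed.

(** Since ad e_1 shifts indices, each of the three sums collapses to one term, and these cancel by
    [str_pascal]. At index 14 the shift would reach e_15, where the coefficient vanishes because 15
    < 15 + l. *)
Lemma jac_1 A j l : supported A -> (0 < j <= 14)%N -> (0 < l <= 14)%N ->
  jac A 1 j l 15 = 0.
Proof.
move=> sA /andP[j0 j14] /andP[l0 l14].
case: (eqVneq j 1%N) => [->|j1]; first exact: jac_iil.
case: (eqVneq l 1%N) => [->|l1]; first exact: jac_iji.
have {j0}j1 : (1 < j)%N by lia.
have {l0}l1 : (1 < l)%N by lia.
have pick f i : (1 < i <= 14)%N -> (i = 14 -> f 15 = 0) ->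
    \sum_(1 <= m < 15) str A 1 i m * f m = f i.+1.
  move=> /andP[i1 i14] f15.
  case: (ltnP i 14) => [i_lt|i_ge].
    rewrite (bigD1_seq i.+1) ?iota_uniq ?mem_index_iota //=.
    rewrite str1 // eqxx mul1r big1 ?addr0 // => m /negPf mi.
    by rewrite str1 // mi mul0r.
  have i_eq : i = 14 by lia.
  rewrite i_eq f15 // big1_seq // => m; rewrite mem_index_iota => /= mP.
  by rewrite str1 // ltn_eqF ?mul0r //; lia.
rewrite /jac !big_split /= (pick (fun m => str A m l 15)) ?j1 //; last first.
  by move=> _; rewrite str_small //; lia.
have -> : \sum_(1 <= m < 15) str A l 1 m * str A m j 15 = - str A l.+1 j 15.
  rewrite -(pick (fun m => str A m j 15)) ?l1 //; last first.
    by move=> _; rewrite str_small //; lia.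
  by rewrite -sumrN; apply: eq_bigr => m _; rewrite (strC _ 1) mulNr.
have -> : \sum_(1 <= m < 15) str A j l m * str A m 1 15 = - str A j l 14.
  rewrite big_nat_recr //= (strC _ 1) str1 // mulrN1 big1_seq ?add0r // => m.
  rewrite mem_index_iota => /= /andP[m1 m14].
  case: (eqVneq m 1%N) => [->|mn1]; first by rewrite strii mulr0.
  by rewrite (strC _ 1) str1 ?gtn_eqF ?oppr0 ?mulr0 //; lia.
by rewrite -(str_pascal _ sA j1 l1) (strC _ j) opprK; ring.
Qed.

End Pascal.

(** * Reduction of closedness to seven triples *)

Section Cocycle.
Variables (k : fieldType) (A : nat -> nat -> k).
Hypothesis char0 : [pchar k] =i pred0.
Hypothesis sA : supported A.

(** A nonzero product would need x + y <= m and m + z <= 15. *)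
Lemma jac_large i j l : (1 < i)%N -> (1 < j)%N -> (1 < l)%N -> (15 < i + j + l)%N ->
  jac A i j l 15 = 0.
Proof.
move=> i1 j1 l1 big_ijl; apply: big1_seq => m; rewrite mem_index_iota => /= mP.
have small x y z : (1 < x)%N -> (1 < y)%N -> (1 < z)%N -> (15 < x + y + z)%N ->
  str A x y m * str A m z 15 = 0.
  move=> x1 y1 z1 xyz; case: (ltnP m (x + y)) => mxy.
    by rewrite str_small // mul0r.
  by rewrite [X in _ * X]str_small ?mulr0 //; lia.
by rewrite !small ?addr0 //; lia.
Qed.

Hypothesis shift : forall i j l, (1 < i < 14)%N -> (1 < j < 14)%N -> (1 < l < 14)%N ->
  jac A i.+1 j l 15 + jac A i j.+1 l 15 + jac A i j l.+1 15 = 0.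
Hypothesis T23 : forall l, l \in [:: 4; 6; 7; 8; 9; 10]%N -> jac A 2 3 l 15 = 0.
Hypothesis T456 : jac A 4 5 6 15 = 0.

(** Invariance relates triples with the same index sum, and those with a repeated index vanish; from
    the given triples the other increasing ones are reached one at a time. *)
Lemma jac_sorted i j l : (1 < i)%N -> (i < j)%N -> (j < l)%N -> (i + j + l <= 15)%N ->
  jac A i j l 15 = 0.
Proof.
pose T i j l := jac A i j l 15.
have S x y z (h : [&& 1 < x < 14, 1 < y < 14 & 1 < z < 14]%N) :
    T x.+1 y z + T x y.+1 z + T x y z.+1 = 0.
  by case/and3P: h => *; exact: shift.
have simp := (@jac_iil k A, @jac_iji k A, @jac_ijj k A, add0r, addr0).
have h4 : T 2 3 4 = 0 by exact: T23.
have h6 : T 2 3 6 = 0 by exact: T23.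
have h7 : T 2 3 7 = 0 by exact: T23.
have h8 : T 2 3 8 = 0 by exact: T23.
have h9 : T 2 3 9 = 0 by exact: T23.
have h10 : T 2 3 10 = 0 by exact: T23.
have h5 : T 2 3 5 = 0 by have := S 2 3 4 isT; rewrite /T !simp.
have T245 : T 2 4 5 = 0 by have := S 2 3 5 isT; rewrite h6 /T !simp.
have T246 : T 2 4 6 = 0 by have := S 2 3 6 isT; rewrite h7 /T !simp.
have T247 : T 2 4 7 = 0 by have := S 2 3 7 isT; rewrite h8 /T !simp.
have T248 : T 2 4 8 = 0 by have := S 2 3 8 isT; rewrite h9 /T !simp.
have T249 : T 2 4 9 = 0 by have := S 2 3 9 isT; rewrite h10 /T !simp.
have T345 : T 3 4 5 = 0 by have := S 2 4 5 isT; rewrite T246 /T !simp.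
have T346 : T 3 4 6 = 0 by have := S 3 4 5 isT; rewrite /T !simp.
have T256 : T 2 5 6 = 0 by have := S 2 4 6 isT; rewrite T247 T346 /T !simp.
(* With T_{2,4,8} = 0 the relations form a cycle T_{3,4,7} = -T_{2,5,7} = T_{3,5,6} = -T_{3,4,7},
   whence 2 T_{3,4,7} = 0. *)
have T347 : T 3 4 7 = 0.
  have /(lin_solve 2%:R) :=
    lin_comb 1 (lin_comb (-1) (S 2 4 7 isT) (S 2 5 6 isT)) (S 3 4 6 isT).
  apply; first by rewrite (pcharf0P k).1.
  have -> : T 4 4 6 = 0 by exact: jac_iil.
  have -> : T 2 6 6 = 0 by exact: jac_ijj.
  by rewrite T248; ring.
have T257 : T 2 5 7 = 0 by have := S 2 4 7 isT; rewrite T248 T347 !simp.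
have T356 : T 3 5 6 = 0 by have := S 3 4 6 isT; rewrite T347 /T !simp.
(* For index sum 15 the five relations leave two of the seven values free, hence the separate check
   on (4, 5, 6). *)
have T357 : T 3 5 7 = 0 by have := S 3 5 6 isT; rewrite [T 4 5 6]T456 /T !simp.
have T348 : T 3 4 8 = 0 by have := S 3 4 7 isT; rewrite T357 /T !simp.
have T258 : T 2 5 8 = 0 by have := S 2 4 8 isT; rewrite T348 T249 /T !simp.
have T267 : T 2 6 7 = 0 by have := S 2 5 7 isT; rewrite T357 T258 /T !simp.
move=> i1 ij jl ijl.
pose L := [:: (2, 3, 4); (2, 3, 5); (2, 3, 6); (2, 3, 7); (2, 3, 8); (2, 3, 9);
  (2, 3, 10); (2, 4, 5); (2, 4, 6); (2, 4, 7); (2, 4, 8); (2, 4, 9); (2, 5, 6);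
  (2, 5, 7); (2, 5, 8); (2, 6, 7); (3, 4, 5); (3, 4, 6); (3, 4, 7); (3, 4, 8);
  (3, 5, 6); (3, 5, 7); (4, 5, 6)]%N.
have in16 x : (x <= 15)%N -> x \in iota 0 16 by rewrite mem_iota.
have enumL : all (fun x => all (fun y => all (fun z =>
    [&& 1 < x, x < y, y < z & x + y + z <= 15]%N ==> ((x, y, z) \in L))
    (iota 0 16)) (iota 0 16)) (iota 0 16) by vm_compute.
have /allP/(_ j (in16 _ _))/allP/(_ l (in16 _ _)) := allP enumL i (in16 i ltac:(lia)).
rewrite i1 ij jl ijl /= => ijlL; have {ijlL} : (i, j, l) \in L by apply: ijlL; lia.
rewrite !inE.
by do 22! (case/orP => [/eqP[-> -> ->] // |]); move=> /eqP[-> -> ->].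
Qed.

Lemma jac_eq0 i j l : (0 < i <= 14)%N -> (0 < j <= 14)%N -> (0 < l <= 14)%N ->
  jac A i j l 15 = 0.
Proof.
move=> iP jP lP.
have sorted0 x y z : (0 < x)%N -> (x <= y)%N -> (y <= z)%N -> (z <= 14)%N ->
    jac A x y z 15 = 0.
  move=> x0 xy yz z14; case: (ltnP 1 x) => x1; last first.
    have -> : x = 1%N by lia.
    by apply: jac_1 => //; lia.
  case: (ltngtP x y) xy => // [xy _|-> _]; last exact: jac_iil.
  case: (ltngtP y z) yz => // [yz _|-> _]; last exact: jac_ijj.
  case: (ltnP 15 (x + y + z)) => h; first by apply: jac_large => //; lia.
  exact: jac_sorted.
have below x y z : (0 < x)%N -> (0 < z)%N -> (x <= y)%N -> (y <= 14)%N ->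
    (z <= 14)%N -> jac A x y z 15 = 0.
  move=> x0 z0 xy y14 z14; case: (leqP y z) => [yz|/ltnW zy]; first exact: sorted0.
  rewrite jac_cycle jac_cycle; case: (leqP z x) => [zx|/ltnW xz]; first exact: sorted0.
  by rewrite jac_swap sorted0 ?oppr0.
case: (leqP i j) => [ij|/ltnW ji]; first by apply: below => //; lia.
by rewrite jac_swap below ?oppr0 //; lia.
Qed.

End Cocycle.

(** As 2l <= j - i - 1, the coefficient of e_r involves only alpha_{k,s} with s <= r, so the column
    s = 15 is not seen. *)
Lemma str_ext (k : fieldType) (alpha : nat -> nat -> k) b i j r :
  (r <= 14)%N -> (j <= 15)%N -> (i <= 15)%N -> str (ext alpha b) i j r = str alpha i j r.
Proof.
move=> r14 j15 i15.
have half x y : (y <= 15)%N -> (x < y)%N ->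
    half_str (ext alpha b) x y r = half_str alpha x y r.
  move=> y15 xy; rewrite /half_str; case: ifP => // _; apply: eq_big_nat => l lP.
  by rewrite /ext ifN //; apply/eqP; lia.
by rewrite /str; case: ltngtP => // h; rewrite half.
Qed.

(** * The symplectic form *)

Section AdaptedBasis.

Variables (k : fieldType) (g : vectType k) (br : {bilinear g -> g -> g}).
Variables (e : nat -> g) (alpha : nat -> nat -> k).
Hypothesis lie_br : lie_bracket br.
Hypothesis basis_e : basis_of fullv [seq e i | i <- iota 1 14].
Hypothesis law : forall i j, (0 < i <= 14)%N -> (0 < j <= 14)%N ->
  br (e i) (e j) = \sum_(1 <= r < 15) str alpha i j r *: e r.

(** Counted from 1 and indexed by [nat] to match the law; only 1 <= r <= 14 is meaningful. *)
Definition coor (r : nat) : g -> k :=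
  coord [tuple of [seq e i | i <- iota 1 14]] (inord r.-1).

HB.instance Definition _ r := GRing.Linear.copy (coor r)
  (coord [tuple of [seq e i | i <- iota 1 14]] (inord r.-1)).

Lemma nth_e n : (n < 14)%N -> [seq e i | i <- iota 1 14]`_n = e n.+1.
Proof. by move=> n14; rewrite (nth_map 0%N) ?size_iota // nth_iota. Qed.

Lemma coorE x : x = \sum_(1 <= r < 15) coor r x *: e r.
Proof.
rewrite [LHS](coord_basis basis_e (memvf x)) big_add1 big_mkord.
apply: eq_bigr => i _; rewrite /coor -pred_Sn inord_val; congr (_ *: _).
exact: nth_e.
Qed.

Lemma coor_e r i : (0 < r <= 14)%N -> (0 < i <= 14)%N -> coor r (e i) = (r == i)%:R.
Proof.
move=> /andP[r0 r14] /andP[i0 i14].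
have i13 : (i.-1 < 14)%N by lia.
have {1}-> : e i = [tuple of [seq e i | i <- iota 1 14]]`_(inord i.-1 : 'I_14).
  by rewrite inordK //; have := nth_e i13; rewrite prednK.
rewrite /coor coord_free ?(basis_free basis_e) //.
by rewrite -val_eqE /= !inordK //; [congr (_%:R); lia | lia].
Qed.

Lemma coor_sum (c : nat -> k) r : (0 < r <= 14)%N ->
  coor r (\sum_(1 <= i < 15) c i *: e i) = c r.
Proof.
move=> rP; rewrite linear_sum (bigD1_seq r) ?iota_uniq ?mem_index_iota //=.
rewrite linearZ /= coor_e // eqxx mulr1 big1_seq ?addr0 // => i.
rewrite mem_index_iota => /andP[/negPf ir iP].
by rewrite linearZ /= coor_e ?(eq_sym r) ?ir ?mulr0 //; lia.
Qed.

Lemma coor_inj x y : (forall r, (0 < r <= 14)%N -> coor r x = coor r y) -> x = y.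
Proof.
move=> xy; rewrite (coorE x) (coorE y); apply: eq_big_nat => r rP.
by rewrite xy //; lia.
Qed.

Lemma brC x y : br x y = - br y x.
Proof.
apply/eqP; rewrite -subr_eq0 opprK; apply/eqP; have := lie_br.1 (x + y).
by rewrite linearDl !linearD /= !lie_br.1 addr0 add0r addrC.
Qed.

Lemma br_derivation x y z : br (br x y) z + br y (br x z) = br x (br y z).
Proof.
rewrite (brC _ z) (brC x z) linearN /= -opprD; apply/eqP.
by rewrite eq_sym -addr_eq0 [X in _ + X]addrC addrA lie_br.2.
Qed.

Lemma jac_alpha0 i j l r : (0 < i <= 14)%N -> (0 < j <= 14)%N -> (0 < l <= 14)%N ->
  (0 < r <= 14)%N -> jac alpha i j l r = 0.
Proof.
move=> iP jP lP rP.
have coor_br x y z : (0 < x <= 14)%N -> (0 < y <= 14)%N -> (0 < z <= 14)%N ->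
    coor r (br (br (e x) (e y)) (e z)) =
    \sum_(1 <= m < 15) str alpha x y m * str alpha m z r.
  move=> xP yP zP; rewrite (law xP yP) linear_sumlz linear_sum; apply: eq_big_nat => m mP.
  by rewrite linearZl_LR linearZ /= law ?coor_sum //; lia.
rewrite /jac !big_split /= -!coor_br // -!linearD /=.
rewrite (brC (br (e i) _)) (brC (br (e j) _)) (brC (br (e l) _)) -!opprD.
by rewrite -addrA addrC lie_br.2 oppr0 linear0.
Qed.

End AdaptedBasis.

Section Symplectic.

Variables (k : fieldType) (g : vectType k) (br : {bilinear g -> g -> g}).
Variables (e : nat -> g) (alpha : nat -> nat -> k).
Hypothesis char0 : [pchar k] =i pred0.
Hypothesis lie_br : lie_bracket br.
Hypothesis basis_e : basis_of fullv [seq e i | i <- iota 1 14].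
Hypothesis supp_alpha : supported alpha.
Hypothesis law : forall i j, (0 < i <= 14)%N -> (0 < j <= 14)%N ->
  br (e i) (e j) = \sum_(1 <= r < 15) str alpha i j r *: e r.

Variable b : nat -> k.
Let A := ext alpha b.
Hypothesis supp_A : supported A.
Hypothesis antidiag : forall i, (0 < i < 15)%N -> str A i (15 - i) 15 != 0.
Hypothesis T23 : forall l, l \in [:: 4; 6; 7; 8; 9; 10]%N -> jac A 2 3 l 15 = 0.
Hypothesis T456 : jac A 4 5 6 15 = 0.

Local Notation co := (coor e).

Definition top_form (x y : g) : k :=
  \sum_(1 <= i < 15) \sum_(1 <= j < 15) str A i j 15 * co i x * co j y.

Lemma top_form_linearl a x y z :
  top_form (a *: x + y) z = a * top_form x z + top_form y z.
Proof.
rewrite /top_form mulr_sumr -big_split; apply: eq_bigr => i _ /=.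
rewrite mulr_sumr -big_split; apply: eq_bigr => j _ /=.
by rewrite linearP /=; ring.
Qed.

Lemma top_formC x y : top_form x y = - top_form y x.
Proof.
rewrite /top_form exchange_big -sumrN; apply: eq_bigr => i _ /=.
rewrite -sumrN; apply: eq_bigr => j _ /=.
by rewrite strC; ring.
Qed.

Lemma top_form_linearr a x y z :
  top_form z (a *: x + y) = a * top_form z x + top_form z y.
Proof. by rewrite top_formC top_form_linearl opprD -mulrN -!top_formC. Qed.

Lemma top_form0l y : top_form 0 y = 0.
Proof.
apply: (addrI (top_form 0 y)).
by rewrite -{1}[top_form 0 y]mul1r -top_form_linearl scale1r !addr0.
Qed.

Lemma top_form_suml (c : nat -> k) y :
  top_form (\sum_(1 <= i < 15) c i *: e i) y = \sum_(1 <= i < 15) c i * top_form (e i) y.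
Proof.
apply: (big_ind2 (fun u v => top_form u y = v)) => [|u1 v1 u2 v2 <- <-|i _].
  exact: top_form0l.
  by rewrite -[u1]scale1r top_form_linearl mul1r scale1r.
by rewrite -[_ *: _]addr0 top_form_linearl top_form0l addr0.
Qed.

Lemma top_formNl x y : top_form (- x) y = - top_form x y.
Proof. by rewrite -[- x]addr0 -scaleN1r top_form_linearl top_form0l addr0 mulN1r. Qed.

Lemma top_form_er x j : (0 < j <= 14)%N ->
  top_form x (e j) = \sum_(1 <= i < 15) str A i j 15 * co i x.
Proof.
move=> jP; apply: eq_bigr => i _.
rewrite (bigD1_seq j) ?iota_uniq ?mem_index_iota //= coor_e // eqxx mulr1.
rewrite big1_seq ?addr0 // => l; rewrite mem_index_iota => /andP[/negPf lj lP].
by rewrite coor_e ?lj ?mulr0 //; lia.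
Qed.

Lemma top_form_e i j : (0 < i <= 14)%N -> (0 < j <= 14)%N ->
  top_form (e i) (e j) = str A i j 15.
Proof.
move=> iP jP; rewrite top_form_er //.
rewrite (bigD1_seq i) ?iota_uniq ?mem_index_iota //= coor_e // eqxx mulr1.
rewrite big1_seq ?addr0 // => l; rewrite mem_index_iota => /andP[/negPf li lP].
by rewrite coor_e ?li ?mulr0 //; lia.
Qed.

(** The differential of [top_form] up to sign, in a form invariant under cyclic permutation. *)
Definition dtop (x y z : g) : k :=
  top_form (br x y) z + top_form (br y z) x + top_form (br z x) y.

Lemma dtop_cycle x y z : dtop x y z = dtop y z x.
Proof. by rewrite /dtop; ring. Qed.

Lemma dtop_linear a x x' y z : dtop (a *: x + x') y z = a * dtop x y z + dtop x' y z.
Proof.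
rewrite /dtop linearDl linearZl_LR [br z _]linearP /= !top_form_linearl top_form_linearr.
by ring.
Qed.

Lemma linear_eq0 (f : g -> k) : (forall a x y, f (a *: x + y) = a * f x + f y) ->
  (forall i, (0 < i <= 14)%N -> f (e i) = 0) -> forall x, f x = 0.
Proof.
move=> fP fe x.
have f0 : f 0 = 0 by apply: (addrI (f 0)); rewrite -{1}[f 0]mul1r -fP scale1r !addr0.
rewrite (coorE basis_e x) big_seq.
apply: (big_ind (fun v => f v = 0)) => // [u v fu fv|i].
  by rewrite -[u]scale1r fP fu fv mulr0 addr0.
rewrite mem_index_iota => iP; rewrite -[_ *: _]addr0 fP f0 fe ?mulr0 ?addr0 //.
Qed.

(** Cyclic invariance carries linearity from the first slot to the others. The vector x stays fixed
    so that the result applies to [e 1] alone. *)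
Lemma trilinear_eq0 (f : g -> g -> g -> k) :
  (forall a x x' y z, f (a *: x + x') y z = a * f x y z + f x' y z) ->
  (forall x y z, f x y z = f y z x) ->
  forall x, (forall i j, (0 < i <= 14)%N -> (0 < j <= 14)%N -> f x (e i) (e j) = 0) ->
  forall y z, f x y z = 0.
Proof.
move=> fP fC x fx y z; move: y; apply: linear_eq0 => [a y y'|i iP].
  by rewrite !(fC x) fP.
move: z; apply: linear_eq0 => [a z z'|j jP]; last exact: fx.
by rewrite -!(fC _ x) fP.
Qed.

Lemma dtop_e i j l : (0 < i <= 14)%N -> (0 < j <= 14)%N -> (0 < l <= 14)%N ->
  dtop (e i) (e j) (e l) = jac A i j l 15.
Proof.
move=> iP jP lP; rewrite /dtop /jac !big_split /=.
have formE x y z : (0 < x <= 14)%N -> (0 < y <= 14)%N -> (0 < z <= 14)%N ->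
  top_form (br (e x) (e y)) (e z) = \sum_(1 <= m < 15) str A x y m * str A m z 15.
  move=> xP yP zP; rewrite (law xP yP) top_form_suml; apply: eq_big_nat => m mP.
  by rewrite top_form_e ?(str_ext alpha b (i := x) (j := y) (r := m)) //; lia.
by rewrite !formE.
Qed.

Lemma dtop_e1 y z : dtop (e 1) y z = 0.
Proof.
apply: trilinear_eq0 => [*|*|i j iP jP]; first exact: dtop_linear.
  exact: dtop_cycle.
by rewrite dtop_e // jac_1.
Qed.

(* By Cartan's formula: [dtop] is closed and its contraction with [e 1] vanishes. *)
Lemma dtop_shift x y z :
  dtop (br (e 1) x) y z + dtop x (br (e 1) y) z + dtop x y (br (e 1) z) = 0.
Proof.
(* The vanishing contraction, rewritten: ad e_1 acts on omega as (u, v) -> omega(e_1, [u, v]). *)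
have inv u v : top_form (br (e 1) u) v + top_form u (br (e 1) v) =
    top_form (e 1) (br u v).
  have := dtop_e1 u v; rewrite /dtop (brC lie_br v) (top_formC (br u v)).
  rewrite top_formNl (top_formC _ u) => E.
  by apply/eqP; rewrite -subr_eq0 -E; apply/eqP; ring.
have addl u v w : top_form (u + v) w = top_form u w + top_form v w.
  by rewrite -[u]scale1r top_form_linearl mul1r scale1r.
have addr u v w : top_form w (u + v) = top_form w u + top_form w v.
  by rewrite -[u]scale1r top_form_linearr mul1r scale1r.
have pair u v w : top_form (br (br (e 1) u) v) w + top_form (br u (br (e 1) v)) w
    + top_form (br u v) (br (e 1) w) = top_form (e 1) (br (br u v) w).
  by rewrite -addl br_derivation // inv.
(* The cyclic sum collects into omega(e_1, J), with J the Jacobi sum of x, y, z. *)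
transitivity (top_form (e 1) (br (br x y) z + br (br y z) x + br (br z x) y)).
  by rewrite !addr -!pair /dtop; ring.
rewrite (brC lie_br (br x y)) (brC lie_br (br y z)) (brC lie_br (br z x)) -!opprD.
by rewrite -addrA addrC lie_br.2 oppr0 top_formC top_form0l oppr0.
Qed.

Lemma shift_e i j l : (1 < i < 14)%N -> (1 < j < 14)%N -> (1 < l < 14)%N ->
  jac A i.+1 j l 15 + jac A i j.+1 l 15 + jac A i j l.+1 15 = 0.
Proof.
move=> iP jP lP; rewrite -!dtop_e; try lia.
have br1 m : (1 < m < 14)%N -> br (e 1) (e m) = e m.+1.
  move=> mP; rewrite law //; try lia.
  rewrite (bigD1_seq m.+1) ?iota_uniq ?mem_index_iota //=; try lia.
  rewrite str1 ?eqxx ?scale1r; last lia.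
  rewrite big1 ?addr0 // => r /negPf rm; rewrite str1 ?rm ?scale0r //; lia.
by rewrite -(br1 i) // -(br1 j) // -(br1 l) // dtop_shift.
Qed.

Lemma dtop_eq0 x y z : dtop x y z = 0.
Proof.
have dtop_e23 i : (0 < i <= 14)%N -> forall u v, dtop (e i) u v = 0.
  move=> iP; apply: trilinear_eq0 => [*|*|j l jP lP]; first exact: dtop_linear.
    exact: dtop_cycle.
  rewrite dtop_e //; apply: jac_eq0 => //; exact: shift_e.
move: x; apply: linear_eq0 => [*|i iP]; first exact: dtop_linear.
exact: dtop_e23.
Qed.

(** Pairing with e_{15-r} isolates the coordinate r: smaller ones vanish by induction, and for i > r
    the matrix entry is 0. *)
Lemma top_form_nondeg x : (forall y, top_form x y = 0) -> x = 0.
Proof.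
move=> x0; suff co0 n : forall r, (0 < r <= 14)%N -> (r <= n)%N -> co r x = 0.
  by apply: (coor_inj basis_e) => r rP; rewrite linear0 (co0 r).
elim: n => [|n IH] r rP rn; first by lia.
have := x0 (e (15 - r)); rewrite top_form_er; last lia.
rewrite (bigD1_seq r) ?iota_uniq ?mem_index_iota //= big1_seq => [|i]; last first.
  rewrite mem_index_iota => /andP[ir iP].
  have [lt_ir|le_ri] := ltnP i r; first by rewrite IH ?mulr0 //; lia.
  have {ir le_ri} lt_ri : (r < i)%N by rewrite ltn_neqAle eq_sym ir.
  (* For r = 14 the partner is e_1, outside the scope of [str_small], but then no index i > r
     remains. *)
  case: (eqVneq r 14) => [r14|r14]; first by lia.
  by rewrite str_small ?mul0r //; lia.
rewrite addr0 => /eqP; rewrite mulf_eq0 (negPf (antidiag _)) //; first by move/eqP.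
Qed.

Lemma symplectic_of_extension : symplectic br.
Proof.
have lin : bilinear_for *%R (idfun \; *%R) top_form.
  split=> [z|z] a x y /=; [exact: top_form_linearl | exact: top_form_linearr].
have herm : forall x y, top_form x y = (-1) ^+ true * idfun (top_form y x).
  by move=> x y; rewrite expr1 mulN1r; exact: top_formC.
pose omega : {skew_symmetric g} := HB.pack top_form
  (bilinear_isBilinear.Build _ _ _ _ _ _ top_form lin)
  (isHermitianSesquilinear.Build _ _ _ _ top_form herm).
exists omega; split.
  rewrite /nondegenerate; apply/eqP/vspaceP=> x; rewrite memv0.
  apply/idP/eqP => [/mem_orthovP x0|->]; last exact: mem0v.
  by apply: top_form_nondeg => y; have := x0 y (memvf y).
move=> x y z; rewrite -(dtop_eq0 x y z) /dtop (brC lie_br z) top_formNl /=.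
by rewrite addrAC.
Qed.

End Symplectic.

(** * Derivations *)

Section Coordinates.
Variables (k : fieldType) (g : vectType k) (br : {bilinear g -> g -> g}).
Variables (e : nat -> g) (alpha : nat -> nat -> k).
Hypothesis basis_e : basis_of fullv [seq e i | i <- iota 1 14].
Hypothesis law : forall i j, (0 < i <= 14)%N -> (0 < j <= 14)%N ->
  br (e i) (e j) = \sum_(1 <= r < 15) str alpha i j r *: e r.

Local Notation co := (coor e).

Lemma coor_brl x j r : (0 < j <= 14)%N -> (0 < r <= 14)%N ->
  co r (br x (e j)) = \sum_(1 <= m < 15) co m x * str alpha m j r.
Proof.
move=> jP rP; rewrite [in LHS](coorE basis_e x) linear_sumlz linear_sum.
apply: eq_big_nat => m mP.
by rewrite linearZl_LR linearZ /= law ?coor_sum //; lia.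
Qed.

Lemma coor_brr y i r : (0 < i <= 14)%N -> (0 < r <= 14)%N ->
  co r (br (e i) y) = \sum_(1 <= m < 15) co m y * str alpha i m r.
Proof.
move=> iP rP; rewrite [in LHS](coorE basis_e y) linear_sumr linear_sum.
apply: eq_big_nat => m mP.
by rewrite linearZr_LR linearZ /= law ?coor_sum //; lia.
Qed.

Lemma coor_br x y r : (0 < r <= 14)%N -> co r (br x y) =
  \sum_(1 <= i < 15) \sum_(1 <= j < 15) co i x * co j y * str alpha i j r.
Proof.
move=> rP; rewrite [in LHS](coorE basis_e x) linear_sumlz linear_sum.
apply: eq_big_nat => m mP.
rewrite linearZl_LR linearZ /= coor_brr // mulr_sumr.
by apply: eq_bigr => j _; rewrite mulrA.
Qed.

Lemma e_in_lcs i j : (j.+1 < i <= 14)%N -> e i \in lcs br j.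
Proof.
elim: j i => [|j IH] i iP; first exact: memvf.
have -> : e i = br (- e i.-1) (e 1) + (br (e i.-1) (e 1) + e i).
  by rewrite linearNl /= addrA addNr add0r.
have -> : br (e i.-1) (e 1) + e i = 0.
  rewrite law; try lia; apply: (coor_inj basis_e) => r rP.
  rewrite linearD linear0 /= coor_sum // coor_e //; last lia.
  rewrite strC str1; last lia.
  by rewrite prednK ?addNr //; lia.
rewrite addr0; apply: (brvP _ _ _ _ (subvv _)); last exact: memvf.
by rewrite memvN; apply: IH; lia.
Qed.

(** Both e_7 and e_8 lie in g^5, and alpha_{7,14} is the e_14-coordinate of [e_7, e_8]. *)
Lemma alpha_7_14_eq0 : condition_b br -> alpha 7 14 = 0.
Proof.
move=> cb.
have : br (e 7) (e 8) \in brv br (lcs br 5) (lcs br 5).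
  by apply: (brvP _ _ _ _ (subvv _)); apply: e_in_lcs.
rewrite cb memv0 => /eqP br78.
have := coor_sum basis_e (str alpha 7 8) (isT : 0 < 14 <= 14)%N.
rewrite -law // br78 linear0 => ->.
by rewrite /str /half_str /law_coef /= big_nat1 expr0 bin0 !mul1r.
Qed.

Hypothesis supp_alpha : supported alpha.

(** The ideal g^1 lies in the span of e_3, ..., e_14, whose brackets start at e_7; the
    e_7-coordinate comes from [e_3, e_4] alone, with coefficient alpha_{3,7}, and e_8, ..., e_14 lie
    in g^6. *)
Lemma alpha_3_7_neq0 : ~ condition_c br -> alpha 3 7 != 0.
Proof.
move=> cc; apply/eqP => a37; apply: cc; apply/brvP => u v u1 v1.
have lcs1 w r : w \in lcs br 1 -> (0 < r <= 2)%N -> co r w = 0.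
  move=> w1 rP; have /subvP/(_ w w1) :
    (lcs br 1 <= <<[tuple of [seq e i | i <- iota 3 12]]>>)%VS.
    apply/brvP => x y _ _; rewrite (coorE basis_e (br x y)) big_seq.
    apply: memv_suml => m; rewrite mem_index_iota => mP; have [m3|m2] := leqP 3 m.
      by apply/memvZ/memv_span/map_f; rewrite mem_iota; lia.
    suff -> : co m (br x y) = 0 by rewrite scale0r mem0v.
    rewrite coor_br; last lia.
    rewrite big1_seq // => i; rewrite mem_index_iota => /= iP.
    rewrite big1_seq // => j; rewrite mem_index_iota => /= jP.
    have [->|i1] := eqVneq i 1%N.
      have [->|j1] := eqVneq j 1%N; first by rewrite strii mulr0.
      by rewrite str1 ?ltn_eqF ?mulr0 //; lia.
    have [->|j1] := eqVneq j 1%N.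
      by rewrite strC str1 ?ltn_eqF ?oppr0 ?mulr0 //; lia.
    by rewrite str_small ?mulr0 //; lia.
  move=> /coord_span ->; rewrite linear_sum big1 // => i _.
  have nthE : [seq e i | i <- iota 3 12]`_i = e (3 + i)%N.
    by rewrite (nth_map 0%N) ?size_iota // nth_iota.
  rewrite [X in _ *: X]nthE linearZ /= coor_e //; last by have := ltn_ord i; lia.
    by rewrite (_ : r == _ = false) ?mulr0 //; apply/eqP; lia.
  by lia.
rewrite (coorE basis_e (br u v)) big_seq; apply: memv_suml => r.
rewrite mem_index_iota => rP; have [r8|r8] := leqP 8 r.
  by apply/memvZ/e_in_lcs; lia.
suff -> : co r (br u v) = 0 by rewrite scale0r mem0v.
rewrite coor_br; last lia.
rewrite big1_seq // => i; rewrite mem_index_iota => /= iP.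
rewrite big1_seq // => j; rewrite mem_index_iota => /= jP.
have [i2|i2] := leqP i 2; first by rewrite (lcs1 u) ?mul0r //; lia.
have [j2|j2] := leqP j 2; first by rewrite (lcs1 v) ?mulr0 ?mul0r //; lia.
have [ij|ij] := ltnP r (i + j); first by rewrite str_small ?mulr0 //; lia.
have str347 : str alpha 3 4 7 = 0.
  by rewrite /str /half_str /law_coef /= big_nat1 expr0 bin0 !mul1r a37.
have [->|nij] := eqVneq i j; first by rewrite strii mulr0.
have /orP[] : [&& i == 3, j == 4 & r == 7]%N || [&& i == 4, j == 3 & r == 7]%N by lia.
  by move=> /and3P[/eqP-> /eqP-> /eqP->]; rewrite str347 mulr0.
move=> /and3P[/eqP-> /eqP-> /eqP->].
by rewrite strC str347 oppr0 mulr0.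
Qed.

End Coordinates.

Lemma sum_window (V : nmodType) (f : nat -> V) lo hi :
  (0 < lo)%N -> (lo <= hi.+1)%N -> (hi < 15)%N ->
  (forall m, (0 < m < 15)%N -> (m < lo)%N || (hi < m)%N -> f m = 0) ->
  \sum_(1 <= m < 15) f m = \sum_(lo <= m < hi.+1) f m.
Proof.
move=> lo0 lohi hi15 f0; rewrite (big_cat_nat (n := lo)) //=; last by lia.
rewrite (big_cat_nat (m := lo) (n := hi.+1)) //=.
rewrite big1_seq ?add0r => [|m]; last first.
  by rewrite mem_index_iota => /= mP; apply: f0; lia.
rewrite [X in _ + X]big1_seq ?addr0 // => m.
by rewrite mem_index_iota => /= mP; apply: f0; lia.
Qed.

(** * Strict triangularity of a derivation *)

Section Derivation.
Variables (k : fieldType) (g : vectType k) (br : {bilinear g -> g -> g}).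
Variables (e : nat -> g) (alpha : nat -> nat -> k).
Hypothesis basis_e : basis_of fullv [seq e i | i <- iota 1 14].
Hypothesis law : forall i j, (0 < i <= 14)%N -> (0 < j <= 14)%N ->
  br (e i) (e j) = \sum_(1 <= r < 15) str alpha i j r *: e r.
Hypothesis sa : supported alpha.
Hypothesis char0 : [pchar k] =i pred0.
Hypothesis a25 : alpha 2 5 = 1.
Hypothesis a37 : 10%:R * alpha 3 7 = 1.
Hypothesis neq0 : 200%:R * alpha 3 8 - 27%:R * alpha 2 6 != 0.

Variable D : 'End(g).
Hypothesis der : derivation br D.

Local Notation co := (coor e).
Local Notation d i r := (coor e r (D (e i))).

Lemma leibniz i j r : (0 < i <= 14)%N -> (0 < j <= 14)%N -> (0 < r <= 14)%N ->
  \sum_(1 <= m < 15) str alpha i j m * d m r =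
  \sum_(1 <= m < 15) d i m * str alpha m j r + \sum_(1 <= m < 15) d j m * str alpha i m r.
Proof.
move=> iP jP rP; rewrite -(coor_brl basis_e law) // -(coor_brr basis_e law) //.
rewrite -linearD /= -der law // linear_sum linear_sum.
by apply: eq_bigr => m _; rewrite !linearZ.
Qed.

(** This is D e_{j+1} = [D e_1, e_j] + [e_1, D e_j]. As [e_1, e_1] = 0, the second bracket has
    nothing on e_1 and e_2. *)
Lemma der_succ j r : (1 < j <= 13)%N -> (0 < r <= 14)%N ->
  d j.+1 r = \sum_(1 <= m < 15) d 1 m * str alpha m j r +
    (if (2 < r)%N then d j r.-1 else 0).
Proof.
move=> jP rP; have := @leibniz 1 j r isT _ rP.
rewrite (@sum_window _ _ j.+1 j.+1) //; try lia; last first.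
  by move=> m mP mj; rewrite str1_neq ?mul0r //; lia.
rewrite big_nat1 str1_eq ?mul1r; last lia.
move=> ->; last lia; congr (_ + _); case: ifP => r2.
  rewrite (@sum_window _ _ r.-1 r.-1) //; try lia; last first.
    move=> m mP mr; have [->|m1] := eqVneq m 1%N; first by rewrite strii mulr0.
    by rewrite str1_neq ?mulr0 //; lia.
  have r1 : r.-1.+1 = r by lia.
  rewrite big_nat1; have := @str1_eq _ alpha r.-1; rewrite r1 => ->; last by lia.
  by rewrite mulr1.
rewrite big1_seq // => m; rewrite mem_index_iota => /= mP.
have [->|m1] := eqVneq m 1%N; first by rewrite strii mulr0.
by rewrite str1_neq ?mulr0 //; lia.
Qed.

Lemma der_succ_small j r : (1 < j <= 13)%N -> (0 < r <= j)%N ->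
  d j.+1 r = if (2 < r)%N then d j r.-1 else 0.
Proof.
move=> jP rP; rewrite der_succ //; last lia.
rewrite big1_seq ?add0r // => m; rewrite mem_index_iota => /= mP.
have [->|m1] := eqVneq m 1%N.
  by rewrite str1_neq ?mulr0 //; lia.
have [->|mj] := eqVneq m j; first by rewrite strii mulr0.
by rewrite str_small ?mulr0 //; lia.
Qed.

Lemma der_trig3 j r : (2 < j <= 14)%N -> (0 < r < j)%N -> d j r = 0.
Proof.
elim: j r => [|j IH] r jP rP; first by lia.
rewrite der_succ_small; try lia; case: ifP => // r2.
by apply: IH; lia.
Qed.

(** In the e_4-coordinate of the Leibniz rule on [e_2, e_3] only the e_1-part of D e_2 contributes,
    through [e_1, e_3] = e_4. *)
Lemma der_2_1 : d 2 1 = 0.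
Proof.
have := @leibniz 2 3 4 isT isT isT.
rewrite big1_seq => [|m]; last first.
  rewrite mem_index_iota => /= mP; have [m5|m5] := leqP 5 m.
    by rewrite der_trig3 ?mulr0 //; lia.
  have [->|m1] := eqVneq m 1%N; first by rewrite str_small ?mul0r //.
  by rewrite str_small ?mul0r //; lia.
rewrite (@sum_window _ _ 1 1) // ?big_nat1 => [|m mP mw]; last first.
  have [->|m3] := eqVneq m 3; first by rewrite strii mulr0.
  by rewrite str_small ?mulr0 //; lia.
rewrite big1_seq ?addr0 => [|m]; last first.
  rewrite mem_index_iota => /= mP; have [m3|m3] := ltnP m 3.
    by rewrite der_trig3 ?mul0r //; lia.
  by rewrite str_small ?mulr0 //; lia.
by rewrite str1 //= mulr1 => <-.
Qed.

Lemma der_trig j r : (1 < j <= 14)%N -> (0 < r < j)%N -> d j r = 0.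
Proof.
move=> jP rP; have [j2|j2] := leqP j 2; last by apply: der_trig3; lia.
have -> : j = 2 by lia.
have -> : r = 1 by lia.
exact: der_2_1.
Qed.

Lemma leibniz_window i j r : (1 < i)%N -> (i < j)%N -> (i + j <= r)%N -> (r <= 14)%N ->
  \sum_(i + j <= m < r.+1) str alpha i j m * d m r =
  \sum_(i <= m < (r - j).+1) d i m * str alpha m j r +
  \sum_(j <= m < (r - i).+1) d j m * str alpha i m r.
Proof.
move=> i1 ij ijr r14; have := @leibniz i j r.
rewrite (@sum_window _ _ (i + j) r); try lia; last first.
  move=> m mP; case: ltnP => /= mw mw'; last by rewrite der_trig ?mulr0 //; lia.
  by rewrite str_small ?mul0r //; lia.
rewrite (@sum_window _ _ i (r - j)); try lia; last first.
  move=> m mP; case: ltnP => /= mw mw'; first by rewrite der_trig ?mul0r //; lia.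
  have [->|mj] := eqVneq m j; first by rewrite strii mulr0.
  by rewrite str_small ?mulr0 //; lia.
rewrite (@sum_window _ _ j (r - i)); try lia; last first.
  move=> m mP; case: ltnP => /= mw mw'; first by rewrite der_trig ?mul0r //; lia.
  by rewrite str_small ?mulr0 //; lia.
by apply; lia.
Qed.

Lemma der_diag j : (1 < j <= 13)%N -> d j.+1 j.+1 = d 1 1 + d j j.
Proof.
move=> jP; rewrite der_succ; try lia; rewrite ifT; last lia.
rewrite (@sum_window _ _ 1 1) // => [|m mP mw]; last first.
  have [->|mj] := eqVneq m j; first by rewrite strii mulr0.
  by rewrite str_small ?mulr0 //; lia.
by rewrite big_nat1 str1_eq ?mulr1 //; lia.
Qed.

Lemma der_subdiag j : (1 < j <= 12)%N ->
  d j.+1 j.+2 = d 1 2 * str alpha 2 j j.+2 + d j j.+1.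
Proof.
move=> jP; rewrite der_succ; try lia; rewrite ifT; last lia.
rewrite (@sum_window _ _ 1 2) // => [|m mP mw]; last first.
  have [->|mj] := eqVneq m j; first by rewrite strii mulr0.
  by rewrite str_small ?mulr0 //; lia.
by rewrite big_nat_recl // big_nat1 str1_neq ?mulr0 ?add0r //; lia.
Qed.

Lemma der_1_1_eq0 : d 1 1 = 0.
Proof.
have s235 : str alpha 2 3 5 = 1 by str_eval sa; rewrite a25; ring.
have s236 : str alpha 2 3 6 = alpha 2 6 by str_eval sa; ring.
have s246 : str alpha 2 4 6 = 1 by str_eval sa; rewrite a25; ring.
have s257 : str alpha 2 5 7 = 1 - alpha 3 7 by str_eval sa; rewrite a25; ring.
have s268 : str alpha 2 6 8 = 1 - 2%:R * alpha 3 7 by str_eval sa; rewrite a25; ring.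
have s347 : str alpha 3 4 7 = alpha 3 7 by str_eval sa; ring.
have s348 : str alpha 3 4 8 = alpha 3 8 by str_eval sa; ring.
have s358 : str alpha 3 5 8 = alpha 3 7 by str_eval sa; ring.
have x3 := @der_diag 2 isT; have x4 := @der_diag 3 isT; have x5 := @der_diag 4 isT.
have x6 := @der_diag 5 isT; have x7 := @der_diag 6 isT; have x8 := @der_diag 7 isT.
have := @der_subdiag 2 isT; have := @der_subdiag 3 isT; have := @der_subdiag 4 isT.
have := @der_subdiag 5 isT; have := @der_subdiag 6 isT.
rewrite strii s235 s246 s257 s268 => y7 y6 y5 y4 y3.
(* The diagonal relation [E5] makes the second diagonal entry twice the first; [E6] and [E8] are
   off-diagonal relations in which the e_3-coordinate of D e_2 cancels. *)
have := @leibniz_window 2 3 5 isT isT isT isT; rewrite !big_nat1 s235 => E5.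
have := @leibniz_window 2 3 6 isT isT isT isT.
rewrite unlock /= strii s235 s236 s246 => E6.
have := @leibniz_window 3 4 8 isT isT isT isT.
rewrite unlock /= strii s347 s348 s358 => E8.
move: E5 E6 E8; rewrite x8 x7 x6 x5 x4 x3 y7 y6 y5 y4 y3.
move: (d 1 1) (d 2 2) (d 1 2) (d 2 3) a37 neq0 => X x2 s y2.
move: (alpha 3 7) (alpha 2 6) (alpha 3 8) => A a b A10 ab0 E5 E6 E8.
have {}E5 : x2 = 2%:R * X.
  move/eqP: E5; rewrite -subr_eq0 => /eqP/(lin_solve (-1)); apply; last ring.
  by rewrite oppr_eq0 oner_neq0.
have {}E6 : 2%:R * s = - a * X.
  move/eqP: E6; rewrite -subr_eq0 => /eqP/(lin_solve 1).
  by apply; [exact: oner_neq0 | rewrite E5; ring].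
have {}E8 : 3%:R * A * (1 - A) * s = - b * X.
  move/eqP: E8; rewrite -subr_eq0 => /eqP/(lin_solve 1).
  by apply; [exact: oner_neq0 | rewrite E5; ring].
(* With A = 1/10 the two relations are 2s = -aX and (27/100) s = -bX; eliminating s gives the factor
   200 b - 27 a. *)
apply: (mulfI ab0); rewrite mulr0.
have -> : (200%:R * b - 27%:R * a) * X = 27%:R * (- a * X) - 200%:R * (- b * X) by ring.
rewrite -E6 -E8.
have -> : 27%:R * (2%:R * s) - 200%:R * (3%:R * A * (1 - A) * s)
  = 54%:R * s - 6%:R * (10%:R * A) * (10%:R - 10%:R * A) * s by ring.
by rewrite A10; ring.
Qed.

Lemma der_lower j r : (0 < j <= 14)%N -> (0 < r <= j)%N -> d j r = 0.
Proof.
have d22 : d 2 2 = 0.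
  have := @leibniz_window 2 3 5 isT isT isT isT; rewrite !big_nat1.
  have -> : str alpha 2 3 5 = 1 by str_eval sa; rewrite a25; ring.
  rewrite (@der_diag 4) // (@der_diag 3) // (@der_diag 2) // der_1_1_eq0 !add0r mulr1 mul1r.
  by move/eqP; rewrite addrC -subr_eq subrr eq_sym => /eqP.
have diag i : (1 < i <= 14)%N -> d i i = 0.
  elim: i => [|i IH] iP; first by lia.
  have [i1|i1] := leqP i 1; first by have -> : i = 1%N by lia.
  by rewrite der_diag ?der_1_1_eq0 ?add0r ?IH //; lia.
move=> jP rP; have [rj|rj] := ltnP r j; first by apply: der_trig; lia.
have -> : r = j by lia.
have [j1|j1] := leqP j 1; last by apply: diag; lia.
have -> : j = 1%N by lia.
exact: der_1_1_eq0.
Qed.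

Lemma derivation_nilpotent : nilpotent_end D.
Proof.
exists 14 => x; apply: (coor_inj basis_e) => r rP; rewrite linear0.
(* Each application of the strictly triangular D clears one more leading coordinate. *)
suff lower n : forall r, (0 < r <= 14)%N -> (r <= n)%N -> co r (iter n D x) = 0.
  by rewrite (lower 14) //; lia.
elim: n {r rP} => [|n IH] r rP rn; first by lia.
rewrite iterS [iter n D x](coorE basis_e) !linear_sum big1_seq // => i.
rewrite mem_index_iota => /= iP; rewrite !linearZ /=.
have [ri|ir] := leqP r i; first by rewrite der_lower ?mulr0 //; lia.
by rewrite IH ?mul0r //; lia.
Qed.

End Derivation.

(** * From an adapted basis to the structure constants, and the conclusion *)

Lemma adapted_law (k : fieldType) (g : vectType k) (br : {bilinear g -> g -> g})
    (e : nat -> g) (alpha : nat -> nat -> k) : lie_bracket br -> adapted br e alpha ->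
  forall i j, (0 < i <= 14)%N -> (0 < j <= 14)%N ->
  br (e i) (e j) = \sum_(1 <= r < 15) str alpha i j r *: e r.
Proof.
move=> lie_br [_ _ br1 br1_14 brij].
have upper i j : (0 < i)%N -> (i < j)%N -> (j <= 14)%N ->
    br (e i) (e j) = \sum_(1 <= r < 15) str alpha i j r *: e r.
  move=> i0 ij j14; have [i1|i1] := leqP i 1; last first.
    rewrite brij //; apply: eq_bigr => r _.
    by rewrite /str ij /half_str gtn_eqF.
  have -> : i = 1%N by lia.
  have j1 : (1 < j)%N by lia.
  have [j13|j13] := leqP j 13.
    rewrite br1; last lia.
    rewrite (bigD1_seq j.+1) ?iota_uniq ?mem_index_iota //= str1_eq // scale1r.
    by rewrite big1 ?addr0 // => r rj; rewrite str1_neq ?scale0r.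
  have -> : j = 14%N by lia.
  rewrite br1_14 big1_seq // => r; rewrite mem_index_iota => /= rP.
  by rewrite str1_neq ?scale0r //; lia.
move=> i j iP jP; case: (ltngtP i j) => ij.
- by apply: upper; lia.
- rewrite brC // upper; try lia; rewrite -sumrN; apply: eq_bigr => r _.
  by rewrite strC scaleNr opprK.
- by rewrite ij lie_br.1 big1 // => r _; rewrite strii scale0r.
Qed.

(** Among the indices of [I14] only (7, 14) lies outside [supp15]. *)
Lemma supported_of_adapted (k : fieldType) (g : vectType k) (br : {bilinear g -> g -> g})
    (e : nat -> g) (alpha : nat -> nat -> k) :
  adapted br e alpha -> alpha 7 14 = 0 -> supported alpha.
Proof.
move=> [_ alpha0 _ _ _] a714 i s; rewrite /supp15 => is0.
have [/andP[/eqP-> /eqP->] //|i7] := boolP ((i == 7) && (s == 14))%N.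
by apply: alpha0; rewrite /I14; lia.
Qed.

Lemma mul_sub_eq0 (k : fieldType) (c x y : k) : c != 0 -> x = c^-1 * y -> c * x - y = 0.
Proof. by move=> c0 ->; rewrite mulVKf // subrr. Qed.

Theorem corollary4p7 (k : fieldType) (char0 : [pchar k] =i pred0)
    (g : vectType k) (br : {bilinear g -> g -> g}) (lie_br : lie_bracket br)
    (filiform_g : filiform br 14)
    (e : nat -> g) (alpha : nat -> nat -> k)
    (law_alpha : in_A14_1_2 br e alpha)
    (neq0 : 200%:R * alpha 3%N 8%N - 27%:R * alpha 2%N 6%N != 0) :
  symplectic br /\ characteristically_nilpotent br.
Proof.
have [[adapted_e _ cond_b cond_c a25] a310] := law_alpha.
have [basis_e _ _ _ _] := adapted_e.
have law := adapted_law lie_br adapted_e.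
have sa := supported_of_adapted adapted_e (alpha_7_14_eq0 basis_e law cond_b).
have a37 := alpha_3_7_neq0 basis_e law sa cond_c.
have jac0 i j l r : (1 < i)%N -> (1 < j)%N -> (1 < l)%N ->
    (i <= 14)%N -> (j <= 14)%N -> (l <= 14)%N -> (0 < r <= 14)%N -> jac alpha i j l r = 0.
  move=> *; apply: (jac_alpha0 lie_br basis_e law) => //; lia.
split; last first.
  move=> D der.
  have ten := ten_a37 char0 sa a25 a37 jac0.
  exact: (derivation_nilpotent basis_e law sa a25 ten neq0 der).
(* Factored, since [natr_neq0] would evaluate the literal in unary. *)
have D0 : 1307611305%:R != 0 :> k.
  have -> : 1307611305%:R = 45%:R * 49%:R * 121%:R * 169%:R * 29%:R :> k by ring.
  by rewrite !mulf_neq0 ?natr_neq0.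
have [b [sA antidiag T23 T456]] :=
  exists_extension char0 sa a25 a37 jac0 (mul_sub_eq0 D0 a310).
exact: (symplectic_of_extension char0 lie_br basis_e law sA antidiag T23 T456).
Qed.
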